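(* Let $\mathfrak{C}$ be a collection of metric families that satisfies Fibering Permanence and contains all metric families with finite asymptotic dimension. Then $\mathfrak{C}$ satisfies Coarse Permanence, Finite Amalgamation Permanence, Finite Union Permanence, Union Permanence and Limit Permanence.
   Context: A metric family is a set of metric spaces. A map of metric families $F\colon\mathcal{X}\to\mathcal{Y}$ is a collection of functions $f\colon X\to Y$ with $X\in\mathcal{X}$, $Y\in\mathcal{Y}$, such that each element of $\mathcal{X}$ is the domain of at least one function in $F$. $F$ is coarse if there is a non-decreasing function $\rho\colon[0,\infty)\to[0,\infty)$ with $d_Y(f(x),f(y))\le\rho(d_X(x,y))$ for all $f\colon X\to Y$ in $F$ and $x,y\in X$. $F$ is effectively proper if there is a proper non-decreasing function $\delta\colon[0,\infty)\to[0,\infty)$ with $\delta(d_X(x,y))\le d_Y(f(x),f(y))$ for all $f\colon X\to Y$ in $F$ and $x,y\in X$. $F$ is a coarse embedding if it is coarse and effectively proper. A subfamily of $\mathcal{Y}$ is a metric family $\mathcal{A}$ such that every $A\in\mathcal{A}$ is a subspace of some $Y\in\mathcal{Y}$. The inverse image of a subfamily $\mathcal{A}$ of $\mathcal{Y}$ under $F\colon\mathcal{X}\to\mathcal{Y}$ is $F^{-1}(\mathcal{A})=\{f^{-1}(A)\mid A\in\mathcal{A},\ f\in F\}$ (where $A$ is a subspace of the codomain of $f$). A metric family $\mathcal{X}$ is bounded if $\sup_{X\in\mathcal{X}}\operatorname{diam}X<\infty$. A collection of subspaces is $r$-disjoint if points in two distinctly indexed members have distance $>r$; an $r$-disjoint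 union is the union of an $r$-disjoint collection. $\operatorname{asdim}(\mathcal{X})\le n$ means: for every $r>0$, each $X\in\mathcal{X}$ has a decomposition $X=X_0\cup\dots\cup X_n$ where each $X_i$ is an $r$-disjoint union of subspaces $X_{ij}$, $j\in J_i$, such that the family of all $X_{ij}$ (over all $X\in\mathcal{X}$, $0\le i\le n$, $j\in J_i$) is bounded. $\mathcal{X}$ has finite asymptotic dimension if $\operatorname{asdim}(\mathcal{X})\le n$ for some $n$. Let $\mathfrak{C}$ be a collection of metric families. - Fibering Permanence: if $F\colon\mathcal{X}\to\mathcal{Y}$ is a coarse map, $\mathcal{Y}\in\mathfrak{C}$, and $F^{-1}(\mathcal{Z})\in\mathfrak{C}$ for every bounded subfamily $\mathcal{Z}$ of $\mathcal{Y}$, then $\mathcal{X}\in\mathfrak{C}$. - Coarse Permanence: if $\mathcal{Y}\in\mathfrak{C}$ and $F\colon\mathcal{X}\to\mathcal{Y}$ is a coarse embedding, then $\mathcal{X}\in\mathfrak{C}$. - Finite Amalgamation Permanence: if $\mathcal{X}=\bigcup_{i=1}^n\mathcal{X}_i$ and each $\mathcal{X}_i\in\mathfrak{C}$, then $\mathcal{X}\in\mathfrak{C}$. - Finite Union Permanence: for $n\in\mathbb{N}$ and $\mathcal{X}_1,\dots,\mathcal{X}_n\in\mathfrak{C}$, if $\mathcal{X}$ is a metric family such that for each $X\in\mathcal{X}$ there exist $X_i\in\mathcal{X}_i$, $1\le i\le n$, with $X=\bigcup_{i=1}^nX_i$, then $\mathcal{X}\in\mathfrak{C}$. - Union Permanence: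 let $\mathcal{X}=\{X_i\}_{i\in I}$ be a metric family in which each $X_i$ is a union of subspaces $X_i=\bigcup_{j\in J_i}X_{ij}$. If $\{X_{ij}\mid i\in I,j\in J_i\}\in\mathfrak{C}$ and for each $r>0$ there exist subspaces $Y_i(r)\subseteq X_i$ such that $\{Y_i(r)\}_{i\in I}\in\mathfrak{C}$ and $\{X_{ij}\setminus Y_i(r)\mid j\in J_i\}$ is an $r$-disjoint collection for each $i\in I$, then $\mathcal{X}\in\mathfrak{C}$. - Limit Permanence: let $\mathcal{X}=\{X_i\}_{i\in I}$ be a metric family. If for every $R>0$ there exist an indexing set $J_R$ and, for each $i\in I$, a decomposition of $X_i$ as an $R$-disjoint union of subspaces $\{Y_{ij}\mid j\in J_R\}$ such that $\{Y_{ij}\mid i\in I,j\in J_R\}\in\mathfrak{C}$, then $\mathcal{X}\in\mathfrak{C}$. *)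

(* Defs.v *)
From Stdlib Require Import Reals.

Local Open Scope R_scope.

(* A metric space is presented as a set of points inside an ambient
   [Metric_Space].  Any [Metric_Space] M arises, with all of M as its set of
   points.  With this presentation a subspace of a subspace of X, and X itself,
   are literally subspaces of X (a sigma type over [Base M] would make them so
   only up to isometry). *)
Record Space : Type := MkSpace {
  ambient : Metric_Space;
  carrier : Base ambient -> Prop
}.

Definition point (X : Space) : Type := {x : Base (ambient X) | carrier X x}.

Coercion point : Space >-> Sortclass.

Definition d (X : Space) (x y : X) : R :=
  dist (ambient X) (proj1_sig x) (proj1_sig y).

Definition subspace (X : Space) (S : X -> Prop) : Space :=
  MkSpace (ambient X)
    (fun x => exists h : carrier X x, S (exist (carrier X) x h)).

Definition is_subspace (A X : Space) : Prop :=
  exists S : X -> Prop, A = subspace X S.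

Definition metric_family : Type := Space -> Prop.

Definition indexed_family {I : Type} (X : I -> Space) : metric_family :=
  fun A => exists i, A = X i.

Definition subfamily (ZZ YY : metric_family) : Prop :=
  forall A, ZZ A -> exists Y, YY Y /\ is_subspace A Y.

Definition bounded_family (XX : metric_family) : Prop :=
  exists D : R, forall X, XX X -> forall x y : X, d X x y <= D.

Definition function_collection : Type := forall X Y : Space, (X -> Y) -> Prop.

Definition family_map (XX YY : metric_family) (F : function_collection) : Prop :=
  (forall (X Y : Space) (f : X -> Y), F X Y f -> XX X /\ YY Y) /\
  (forall X, XX X -> exists (Y : Space) (f : X -> Y), F X Y f).

(* Functions from [0,oo) to [0,oo) are represented by functions on R whose
   values at negative arguments are irrelevant. *)
Definition maps_nonneg (rho : R -> R) : Prop :=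
  forall t, 0 <= t -> 0 <= rho t.

Definition nondecreasing (rho : R -> R) : Prop :=
  forall s t, 0 <= s -> s <= t -> rho s <= rho t.

(* Preimages of bounded subsets of [0,oo) are bounded. *)
Definition proper (delta : R -> R) : Prop :=
  forall M, exists B, forall t, 0 <= t -> delta t <= M -> t <= B.

Definition coarse (F : function_collection) : Prop :=
  exists rho : R -> R,
    maps_nonneg rho /\ nondecreasing rho /\
    forall (X Y : Space) (f : X -> Y), F X Y f ->
      forall x y : X, d Y (f x) (f y) <= rho (d X x y).

Definition effectively_proper (F : function_collection) : Prop :=
  exists delta : R -> R,
    maps_nonneg delta /\ nondecreasing delta /\ proper delta /\
    forall (X Y : Space) (f : X -> Y), F X Y f ->
      forall x y : X, delta (d X x y) <= d Y (f x) (f y).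

Definition coarse_embedding (F : function_collection) : Prop :=
  coarse F /\ effectively_proper F.

Definition inverse_image (F : function_collection) (ZZ : metric_family)
  : metric_family :=
  fun B => exists (X Y : Space) (f : X -> Y) (S : Y -> Prop),
    F X Y f /\ ZZ (subspace Y S) /\ B = subspace X (fun x => S (f x)).

Definition r_disjoint (r : R) (X : Space) {J : Type} (U : J -> X -> Prop)
  : Prop :=
  forall j k, j <> k -> forall x y : X, U j x -> U k y -> r < d X x y.

Definition r_disjoint_union (r : R) (X : Space) (S : X -> Prop)
  {J : Type} (U : J -> X -> Prop) : Prop :=
  (forall x : X, S x <-> exists j, U j x) /\ r_disjoint r X U.

Definition asdim_le (XX : metric_family) (n : nat) : Prop :=
  forall r : R, 0 < r ->
    exists (P : forall X : Space, nat -> X -> Prop)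
           (J : Space -> nat -> Type)
           (U : forall (X : Space) (i : nat), J X i -> X -> Prop),
      (forall X, XX X ->
         (forall x : X, exists i, (i <= n)%nat /\ P X i x) /\
         (forall i, (i <= n)%nat ->
            r_disjoint_union r X (P X i) (U X i))) /\
      bounded_family (fun A => exists (X : Space) i (j : J X i),
         XX X /\ (i <= n)%nat /\ A = subspace X (U X i j)).

Definition finite_asdim (XX : metric_family) : Prop :=
  exists n, asdim_le XX n.

Definition fibering_permanence (C : metric_family -> Prop) : Prop :=
  forall (XX YY : metric_family) (F : function_collection),
    family_map XX YY F -> coarse F -> C YY ->
    (forall ZZ, subfamily ZZ YY -> bounded_family ZZ ->
       C (inverse_image F ZZ)) ->
    C XX.

Definition coarse_permanence (C : metric_family -> Prop) : Prop :=
  forall (XX YY : metric_family) (F : function_collection),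
    C YY -> family_map XX YY F -> coarse_embedding F -> C XX.

Definition finite_amalgamation_permanence (C : metric_family -> Prop) : Prop :=
  forall (n : nat) (XX : metric_family) (XXi : nat -> metric_family),
    (forall X, XX X <-> exists i, (1 <= i <= n)%nat /\ XXi i X) ->
    (forall i, (1 <= i <= n)%nat -> C (XXi i)) ->
    C XX.

Definition finite_union_permanence (C : metric_family -> Prop) : Prop :=
  forall (n : nat) (XXi : nat -> metric_family) (XX : metric_family),
    (forall i, (1 <= i <= n)%nat -> C (XXi i)) ->
    (forall X, XX X ->
       exists S : nat -> X -> Prop,
         (forall i, (1 <= i <= n)%nat -> XXi i (subspace X (S i))) /\
         (forall x : X, exists i, (1 <= i <= n)%nat /\ S i x)) ->
    C XX.

Definition union_permanence (C : metric_family -> Prop) : Prop :=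
  forall (I : Type) (X : I -> Space) (J : I -> Type)
         (U : forall i, J i -> X i -> Prop),
    (forall i (x : X i), exists j, U i j x) ->
    C (fun A => exists i j, A = subspace (X i) (U i j)) ->
    (forall r : R, 0 < r ->
       exists V : forall i, X i -> Prop,
         C (indexed_family (fun i => subspace (X i) (V i))) /\
         forall i, r_disjoint r (X i) (fun j x => U i j x /\ ~ V i x)) ->
    C (indexed_family X).

Definition limit_permanence (C : metric_family -> Prop) : Prop :=
  forall (I : Type) (X : I -> Space),
    (forall r : R, 0 < r ->
       exists (J : Type) (U : forall i, J -> X i -> Prop),
         (forall i, r_disjoint_union r (X i) (fun _ => True) (U i)) /\
         C (fun A => exists i j, A = subspace (X i) (U i j))) ->
    C (indexed_family X).

(* Main.v *)
Require Import Defs.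
From Stdlib Require Import Reals Lra Lia Arith ZArith Relations Wf_nat.
From Stdlib Require Import Classical IndefiniteDescription.
From Stdlib Require Import FunctionalExtensionality PropExtensionality.
From Stdlib Require Import ProofIrrelevance.

Local Open Scope R_scope.

(** Each permanence property is obtained from Fibering Permanence by a coarse
    map whose target is of finite asymptotic dimension or already known to be
    in the class, and whose inverse images of bounded families are simpler than
    the source.

    Bounded families have asymptotic dimension 0, so they belong to the class;
    since a coarse embedding pulls bounded families back to bounded families,
    Coarse Permanence follows. It is mostly used through near isometries, maps
    that change distances by at most a constant
    ([near_isometric_in_class]): they cover passing to subspaces and replacing
    a subspace by a neighbourhood of it.

    For the amalgamation of two families, send the members of the first to
    themselves and those of the second to a point
    ([union_of_two_families_in_class]).

    For a union X of two subspaces A and B, map x to its distance to A, a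
    1-Lipschitz map to the real line, which has asymptotic dimension 1. The
    inverse image of a set of diameter D either meets A, and then lies in a
    neighbourhood of A of controlled radius, or misses A, and then lies in B
    ([union_of_two_in_class]).

    For Limit Permanence, let the level of (x, y) be the least natural number n
    such that x and y are joined by a chain with steps of length at most n.
    This is an ultrametric, hence of asymptotic dimension 0, and it is at most
    the distance plus 1. A set of bounded level lies in a single piece of every
    decomposition of large enough disjointness ([limit_in_class]).

    For Union Permanence, let V n be the subspace outside of which the pieces
    are n-disjoint, and map x to the infimum of n + d(x, y) over all n and all
    y in V n. On an inverse image of a set of diameter D this function varies by
    at most D. Given m, either the inverse image meets V m, so the function is
    at most m + D on it and it lies in a finite union of neighbourhoods of the
    V n; or it misses V m, and its intersections with the pieces are
    m-disjoint. Letting m grow, Limit Permanence applies to the family of these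
    inverse images ([exhausted_union_in_class]). *)

(** * Points, subspaces and near isometries *)

Lemma d_nonneg (X : Space) (x y : X) : 0 <= d X x y.
Proof. apply Rge_le, dist_pos. Qed.

Lemma d_sym (X : Space) (x y : X) : d X x y = d X y x.
Proof. apply dist_sym. Qed.

Lemma d_triangle (X : Space) (x y z : X) : d X x z <= d X x y + d X y z.
Proof. apply dist_tri. Qed.

Lemma d_refl (X : Space) (x : X) : d X x x = 0.
Proof. now apply dist_refl. Qed.

Lemma d_separates (X : Space) (x y : X) : d X x y = 0 -> x = y.
Proof.
  destruct x as [x hx], y as [y hy]; unfold d; simpl; intros H.
  apply dist_refl in H. now apply subset_eq_compat.
Qed.

Definition forget {X : Space} {S : X -> Prop} (p : subspace X S) : X :=
  exist (carrier X) (proj1_sig p)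
    (match proj2_sig p with ex_intro _ h _ => h end).

Lemma forget_in (X : Space) (S : X -> Prop) (p : subspace X S) : S (forget p).
Proof. destruct p as [x [h s]]. exact s. Qed.

Lemma subspace_point (X : Space) (S : X -> Prop) (x : X) :
  S x -> exists p : subspace X S, forget p = x.
Proof.
  destruct x as [x h]; intros s.
  now exists (exist (carrier (subspace X S)) x (ex_intro _ h s)).
Qed.

Definition near_isometric (K : R) (X Y : Space) : Prop :=
  exists f : X -> Y, forall x y, Rabs (d Y (f x) (f y) - d X x y) <= K.

Lemma Rabs_le_bounds (a K : R) : Rabs a <= K -> - K <= a <= K.
Proof. unfold Rabs. destruct Rcase_abs; lra. Qed.

Lemma isometric_near_isometric (X Y : Space) (f : X -> Y) :
  (forall x y, d Y (f x) (f y) = d X x y) -> near_isometric 0 X Y.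
Proof.
  intros hf. exists f. intros x y. rewrite hf, Rminus_diag, Rabs_R0. lra.
Qed.

Lemma near_isometric_refl (X : Space) : near_isometric 0 X X.
Proof. now apply isometric_near_isometric with (fun x => x). Qed.

Lemma near_isometric_weaken (K L : R) (X Y : Space) :
  K <= L -> near_isometric K X Y -> near_isometric L X Y.
Proof.
  intros hKL [f hf]. exists f. intros x y. now apply Rle_trans with K.
Qed.

Lemma near_isometric_trans (K L : R) (X Y Z : Space) :
  near_isometric K X Y -> near_isometric L Y Z -> near_isometric (K + L) X Z.
Proof.
  intros [f hf] [g hg]. exists (fun x => g (f x)). intros x y.
  specialize (hf x y). specialize (hg (f x) (f y)).
  revert hf hg. unfold Rabs. repeat destruct Rcase_abs; lra.
Qed.

(** Moving each point to a nearest one, up to an error, changes distances by at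
    most twice the displacement: a neighbourhood of a subspace looks like the
    subspace at large scale. *)
Lemma near_isometric_to_subspace (K : R) (A X : Space) (phi : A -> X)
  (T : X -> Prop) :
  (forall a b, d X (phi a) (phi b) = d A a b) ->
  (forall a, exists y, T y /\ d X (phi a) y <= K) ->
  near_isometric (2 * K) A (subspace X T).
Proof.
  intros hphi hT.
  assert (hq : forall a, exists p : subspace X T, d X (phi a) (forget p) <= K).
  { intros a. destruct (hT a) as [y [hy hd]].
    destruct (subspace_point X T y hy) as [p hp]. exists p. now rewrite hp. }
  destruct (functional_choice _ hq) as [f hf]. exists f. intros a b.
  change (d (subspace X T) (f a) (f b)) with (d X (forget (f a)) (forget (f b))).
  rewrite <- hphi.
  pose proof (hf a) as ha. pose proof (hf b) as hb.
  pose proof (d_triangle X (phi a) (forget (f a)) (phi b)).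
  pose proof (d_triangle X (forget (f a)) (forget (f b)) (phi b)).
  pose proof (d_triangle X (forget (f a)) (phi a) (forget (f b))).
  pose proof (d_triangle X (phi a) (phi b) (forget (f b))).
  pose proof (d_sym X (forget (f a)) (phi a)).
  pose proof (d_sym X (forget (f b)) (phi b)).
  apply Rabs_le. lra.
Qed.

Lemma isometric_to_subspace (A X : Space) (phi : A -> X) (T : X -> Prop) :
  (forall a b, d X (phi a) (phi b) = d A a b) ->
  (forall a, T (phi a)) ->
  near_isometric 0 A (subspace X T).
Proof.
  intros hphi hT. replace 0 with (2 * 0) by ring.
  apply near_isometric_to_subspace with phi; trivial.
  intros a. exists (phi a). rewrite d_refl. split; [apply hT | lra].
Qed.

(** * Families of finite asymptotic dimension *)

(** The decompositions may be given for one space at a time, provided that the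
    bound on the pieces depends only on the scale. *)
Lemma asdim_le_intro (XX : metric_family) (n : nat) :
  (forall r, 0 < r -> exists D, forall X, XX X ->
     exists (J : nat -> Type) (U : forall i, J i -> X -> Prop),
       (forall x, exists i j, (i <= n)%nat /\ U i j x) /\
       (forall i, (i <= n)%nat -> r_disjoint r X (U i)) /\
       (forall i j x y, (i <= n)%nat -> U i j x -> U i j y -> d X x y <= D)) ->
  asdim_le XX n.
Proof.
  intros H r hr. destruct (H r hr) as [D HD].
  pose (T := fun X : Space => {J : nat -> Type & forall i, J i -> X -> Prop}).
  assert (HT : forall X : Space, exists p : T X, XX X ->
     (forall x, exists i j, (i <= n)%nat /\ projT2 p i j x) /\
     (forall i, (i <= n)%nat -> r_disjoint r X (projT2 p i)) /\
     (forall i j x y, (i <= n)%nat ->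
        projT2 p i j x -> projT2 p i j y -> d X x y <= D)).
  { intros X. destruct (classic (XX X)) as [hX | hX].
    - destruct (HD X hX) as [J [U HU]].
      now exists (existT (fun J => forall i, J i -> X -> Prop) J U).
    - exists (existT (fun J => forall i, J i -> X -> Prop)
               (fun _ => unit) (fun _ _ _ => True)).
      intros hX'. contradiction. }
  pose (p := fun X => proj1_sig (constructive_indefinite_description _ (HT X))).
  assert (Hp := fun X =>
    proj2_sig (constructive_indefinite_description _ (HT X))).
  fold T in Hp. change (forall X, XX X ->
     (forall x, exists i j, (i <= n)%nat /\ projT2 (p X) i j x) /\
     (forall i, (i <= n)%nat -> r_disjoint r X (projT2 (p X) i)) /\
     (forall i j x y, (i <= n)%nat ->
        projT2 (p X) i j x -> projT2 (p X) i j y -> d X x y <= D)) in Hp.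
  clearbody p.
  exists (fun X i x => exists j, projT2 (p X) i j x), (fun X => projT1 (p X)),
    (fun X => projT2 (p X)).
  split.
  - intros X hX. destruct (Hp X hX) as [Hc [Hd _]]. split.
    + intros x. destruct (Hc x) as [i [j [hi hj]]]. now exists i; split; [|exists j].
    + intros i hi. split; [tauto | now apply Hd].
  - exists D. intros A [X [i [j [hX [hi ->]]]]] x y.
    destruct (Hp X hX) as [_ [_ Hb]].
    apply (Hb i j (forget x) (forget y) hi); apply forget_in.
Qed.

Lemma bounded_family_asdim (XX : metric_family) :
  bounded_family XX -> finite_asdim XX.
Proof.
  intros [D HD]. exists 0%nat. apply asdim_le_intro. intros r _. exists D.
  intros X hX. exists (fun _ => unit), (fun _ _ _ => True). split; [|split].
  - intros x. now exists 0%nat, tt.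
  - intros i _ [] []. now intros [].
  - intros i j x y _ _ _. now apply HD.
Qed.

Definition line : Space := MkSpace R_met (fun _ => True).

Definition line_point (t : R) : line := exist (carrier line) t I.

Definition line_value (x : line) : R := proj1_sig x.

Lemma line_dist (x y : line) : d line x y = Rabs (line_value x - line_value y).
Proof. reflexivity. Qed.

(** At scale [r], the intervals of length [r] with even, respectively odd,
    number are [r]-disjoint: two of the same parity are separated by a whole
    interval, and half-open intervals make the separation strict. *)
Lemma line_asdim : finite_asdim (fun X => X = line).
Proof.
  exists 1%nat. apply asdim_le_intro. intros r hr. exists r. intros X ->.
  exists (fun _ => Z), (fun i k (x : line) =>
    r * IZR (2 * k + Z.of_nat i) <= line_value x
      < r * IZR (2 * k + Z.of_nat i + 1)).
  split; [|split].
  - intros x. pose (t := line_value x).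
    destruct (base_Int_part (t / r)) as [h1 h2].
    set (m := Int_part (t / r)) in *.
    assert (ht : r * IZR m <= t < r * IZR (m + 1)).
    { assert (e : t = r * (t / r)) by (field; lra).
      rewrite plus_IZR. split; [rewrite e | rewrite e at 1].
      - apply Rmult_le_compat_l; lra.
      - apply Rmult_lt_compat_l; lra. }
    pose proof (Z.div_mod m 2) as hm.
    pose proof (Z.mod_pos_bound m 2) as hb.
    exists (Z.to_nat (m mod 2)), (m / 2)%Z. split; [lia|].
    replace (2 * (m / 2) + Z.of_nat (Z.to_nat (m mod 2)))%Z with m by lia.
    exact ht.
  - intros i _.
    assert (far : forall (j k : Z) (x y : line), (j < k)%Z ->
      r * IZR (2 * j + Z.of_nat i) <= line_value x
        < r * IZR (2 * j + Z.of_nat i + 1) ->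
      r * IZR (2 * k + Z.of_nat i) <= line_value y
        < r * IZR (2 * k + Z.of_nat i + 1) ->
      r < d line y x).
    { intros j k x y hjk [_ hx] [hy _]. rewrite line_dist.
      apply Rlt_le_trans with (line_value y - line_value x); [|apply Rle_abs].
      assert (IZR (2 * j + Z.of_nat i + 1) + 1 <= IZR (2 * k + Z.of_nat i)).
      { rewrite <- plus_IZR. apply IZR_le. lia. }
      assert (r * (IZR (2 * j + Z.of_nat i + 1) + 1)
              <= r * IZR (2 * k + Z.of_nat i))
        by (apply Rmult_le_compat_l; lra).
      lra. }
    intros j k hjk x y hx hy.
    destruct (Z.lt_total j k) as [h | [h | h]]; [| contradiction |].
    + rewrite d_sym. now apply (far j k).
    + now apply (far k j).
  - intros i j x y _ [hx hx'] [hy hy']. rewrite line_dist.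
    rewrite plus_IZR in hx', hy'. apply Rabs_le. lra.
Qed.

(** * Weighted distance functions *)

(** [g] is, up to an error of 1, the infimum over the points [y] of [W n] of
    [INR n + d X x y]. *)
Definition weighted_distance (X : Space) (W : nat -> X -> Prop) (g : X -> R)
  : Prop :=
  (forall x y, g x <= g y + d X x y) /\
  (forall n y, W n y -> g y <= INR n) /\
  ((exists n y, W n y) ->
   forall x, exists n y, W n y /\ INR n + d X x y <= g x + 1).

Lemma weighted_distance_exists (X : Space) (W : nat -> X -> Prop) :
  exists g, weighted_distance X W g.
Proof.
  destruct (classic (exists n y, W n y)) as [hW | hW].
  2: { exists (fun _ => 0). split; [|split].
       - intros x y. pose proof (d_nonneg X x y). lra.
       - intros n y hy. exfalso. apply hW. now exists n, y.
       - contradiction. }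
  (* Completeness speaks of suprema, whence the change of sign. *)
  pose (E := fun x t => exists n y, W n y /\ t = - (INR n + d X x y)).
  assert (hsup : forall x, exists m, is_lub (E x) m).
  { intros x. destruct (completeness (E x)) as [m hm]; [| |now exists m].
    - exists 0. intros t [n [y [_ ->]]].
      pose proof (pos_INR n). pose proof (d_nonneg X x y). lra.
    - destruct hW as [n [y hy]]. now exists (- (INR n + d X x y)), n, y. }
  destruct (functional_choice _ hsup) as [m hm].
  exists (fun x => - m x). split; [|split].
  - intros x y. enough (m y <= m x + d X x y) by lra.
    apply (hm y). intros t [n [z [hz ->]]].
    assert (- (INR n + d X x z) <= m x).
    { apply (hm x). now exists n, z. }
    pose proof (d_triangle X x y z). lra.
  - intros n y hy. enough (- (INR n + d X y y) <= m y)
      by (rewrite d_refl in *; lra).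
    apply (hm y). now exists n, y.
  - intros _ x. apply NNPP. intros hno.
    enough (m x <= m x - 1) by lra.
    apply (hm x). intros t [n [y [hy ->]]]. apply Rnot_lt_le. intros hlt.
    apply hno. exists n, y. split; [trivial | lra].
Qed.

(** * The chain ultrametric *)

Definition chained (X : Space) (n : nat) : X -> X -> Prop :=
  clos_refl_sym_trans X (fun x y => d X x y <= INR n).

Lemma chained_mono (X : Space) (m n : nat) (x y : X) :
  (m <= n)%nat -> chained X m x y -> chained X n x y.
Proof.
  intros hmn. apply le_INR in hmn. induction 1.
  - apply rst_step. lra.
  - apply rst_refl.
  - now apply rst_sym.
  - now apply rst_trans with y.
Qed.

Lemma nat_above (t : R) : exists n, t <= INR n.
Proof.
  exists (Z.to_nat (up t)). rewrite INR_IZR_INZ.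
  apply Rle_trans with (IZR (up t)); [left; apply archimed|].
  apply IZR_le. lia.
Qed.

Lemma nat_between (t : R) : 0 <= t -> exists n, t <= INR n <= t + 1.
Proof.
  intros ht. destruct (archimed t) as [h1 h2].
  assert (0 < up t)%Z by (apply lt_IZR; lra).
  exists (Z.to_nat (up t)). rewrite INR_IZR_INZ, Z2Nat.id by lia. lra.
Qed.

Lemma least_chain (X : Space) (x y : X) :
  exists n, chained X n x y /\ forall m, chained X m x y -> (n <= m)%nat.
Proof.
  destruct (dec_inh_nat_subset_has_unique_least_element
              (fun n => chained X n x y)) as [n [hn _]].
  - intros n. apply classic.
  - destruct (nat_above (d X x y)) as [n hn]. exists n. now apply rst_step.
  - now exists n.
Qed.

Definition level (X : Space) (x y : X) : nat :=
  proj1_sig (constructive_indefinite_description _ (least_chain X x y)).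

Lemma level_le (X : Space) (x y : X) (n : nat) :
  (level X x y <= n)%nat <-> chained X n x y.
Proof.
  unfold level.
  destruct (constructive_indefinite_description _ _) as [m [hm hmin]]; simpl.
  split; [intros h; now apply chained_mono with m | apply hmin].
Qed.

Lemma level_sym (X : Space) (x y : X) : level X x y = level X y x.
Proof.
  apply Nat.le_antisymm; apply level_le, rst_sym, level_le, Nat.le_refl.
Qed.

Lemma level_ultrametric (X : Space) (x y z : X) :
  (level X x z <= Nat.max (level X x y) (level X y z))%nat.
Proof.
  apply level_le, rst_trans with y; apply level_le; lia.
Qed.

(** Integral levels matter here: points joined by chains of arbitrarily small
    steps need not coincide, but a chain of steps of length zero is constant. *)
Lemma level_separates (X : Space) (x y : X) : level X x y = 0%nat <-> x = y.
Proof.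
  split.
  - intros h. assert (hc : chained X 0 x y) by (apply level_le; lia).
    clear h. induction hc as [x y h | x | x y _ IH | x y z _ IH1 _ IH2].
    + apply d_separates. pose proof (d_nonneg X x y). simpl in h. lra.
    + reflexivity.
    + now symmetry.
    + now transitivity y.
  - intros ->. apply Nat.le_0_r, level_le, rst_refl.
Qed.

Lemma level_lipschitz (X : Space) (x y : X) :
  INR (level X x y) <= d X x y + 1.
Proof.
  destruct (nat_between (d X x y) (d_nonneg X x y)) as [n [hn hn']].
  apply Rle_trans with (INR n); [|trivial].
  apply le_INR, level_le. now apply rst_step.
Qed.

(* Transparent, so that points and distances of [level_space X] compute to
   those given here. *)
Definition level_metric (X : Space) : Metric_Space.
Proof.
  refine (Build_Metric_Space (point X) (fun x y => INR (level X x y)) _ _ _ _).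
  - intros x y. apply Rle_ge, pos_INR.
  - intros x y. now rewrite level_sym.
  - intros x y. rewrite <- level_separates. split.
    + intros h. now apply INR_eq.
    + now intros ->.
  - intros x y z. rewrite <- plus_INR. apply le_INR.
    pose proof (level_ultrametric X x z y). lia.
Defined.

Definition level_space (X : Space) : Space :=
  MkSpace (level_metric X) (fun _ => True).

Definition level_point (X : Space) (x : X) : level_space X :=
  exist (carrier (level_space X)) x I.

Lemma level_dist (X : Space) (x y : level_space X) :
  d (level_space X) x y = INR (level X (proj1_sig x) (proj1_sig y)).
Proof. reflexivity. Qed.

(** In an ultrametric space the closed balls of radius [r] partition the space
    into [r]-disjoint pieces. Indexing the pieces by the balls themselves makes
    distinct indices stand for distinct pieces. *)
Lemma level_asdim (XX : metric_family) :
  finite_asdim (fun Y => exists X, XX X /\ Y = level_space X).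
Proof.
  exists 0%nat. apply asdim_le_intro. intros r hr. exists r.
  intros Y [X [_ ->]]. set (Y := level_space X).
  assert (htri : forall x y z, d Y x y <= r -> d Y y z <= r -> d Y x z <= r).
  { intros x y z. unfold Y. rewrite !level_dist. intros h1 h2.
    eapply Rle_trans; [apply le_INR, level_ultrametric with (y := proj1_sig y)|].
    apply Nat.max_case; trivial. }
  exists (fun _ => Y -> Prop), (fun _ B x => B = fun z => d Y x z <= r).
  split; [|split].
  - intros x. now exists 0%nat, (fun z => d Y x z <= r).
  - intros _ _ A B hAB x y -> ->. apply Rnot_le_lt. intros hxy. apply hAB.
    apply functional_extensionality. intros z.
    apply propositional_extensionality. split; intros hz.
    + apply htri with x; trivial. now rewrite d_sym.
    + now apply htri with y.
  - intros _ A x y _ hx hy. change ((fun z => d Y x z <= r) y).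
    rewrite <- hx, hy, d_refl. lra.
Qed.

(** A step of length at most [r] cannot lead from one piece to another. *)
Lemma chained_same_piece (X : Space) (J : Type) (U : J -> X -> Prop) (r : R)
  (n : nat) (x y : X) :
  (forall z, exists j, U j z) -> r_disjoint r X U -> INR n <= r ->
  chained X n x y -> forall j, U j x <-> U j y.
Proof.
  intros hcov hdis hn. induction 1 as [x y h | x | x y _ IH | x y z _ IH1 _ IH2].
  - assert (same : forall j k, U j x -> U k y -> j = k).
    { intros j k hj hk. apply NNPP. intros hne.
      pose proof (hdis j k hne x y hj hk). lra. }
    intros j. split; intros hj.
    + destruct (hcov y) as [k hk]. now rewrite (same j k hj hk).
    + destruct (hcov x) as [k hk]. now rewrite <- (same k j hk hj).
  - reflexivity.
  - intros j. now rewrite IH.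
  - intros j. now rewrite IH1.
Qed.

(** * Maps to the line and to the level space *)

(** A function collection relates spaces that are arguments of its type; stating
    that the target is the line by an index of an inductive family avoids
    transporting functions along equations between spaces. *)
Inductive line_map (good : forall X : Space, (X -> R) -> Prop)
  : function_collection :=
| line_map_intro X g : good X g -> line_map good X line (fun x => line_point (g x)).

Inductive level_map (XX : metric_family) : function_collection :=
| level_map_intro X : XX X -> level_map XX X (level_space X) (level_point X).

Section Fibering.

Context {C : metric_family -> Prop}.
Context (hfib : fibering_permanence C).
Context (hasdim : forall XX : metric_family, finite_asdim XX -> C XX).

Lemma bounded_in_class (XX : metric_family) : bounded_family XX -> C XX.
Proof. intros h. now apply hasdim, bounded_family_asdim. Qed.

(** * Coarse and finite amalgamation permanence *)

Lemma fibering_coarse : coarse_permanence C.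
Proof.
  intros XX YY F hY hF [hc [delta [_ [_ [hp hd]]]]].
  apply (hfib XX YY F hF hc hY). intros ZZ _ [D hD].
  destruct (hp D) as [B hB].
  apply bounded_in_class. exists B.
  intros A [X [Y [f [S [hf [hZ ->]]]]]] x y.
  apply hB; [apply d_nonneg|].
  apply Rle_trans with (1 := hd X Y f hf (forget x) (forget y)).
  destruct (subspace_point Y S (f (forget x))) as [p hp'].
  { exact (forget_in X _ x). }
  destruct (subspace_point Y S (f (forget y))) as [q hq].
  { exact (forget_in X _ y). }
  rewrite <- hp', <- hq. exact (hD _ hZ p q).
Qed.

(** A map that distorts distances by at most [K] is a coarse embedding, with
    control functions [t + Rabs K] and [Rmax 0 (t - Rabs K)]. *)
Lemma near_isometric_in_class_strict (K : R) (YY XX : metric_family) :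
  C YY ->
  (forall X, XX X -> exists Y, YY Y /\ near_isometric K X Y) ->
  C XX.
Proof.
  intros hY H.
  apply (fibering_coarse XX YY (fun X Y f => XX X /\ YY Y /\
    forall x y, Rabs (d Y (f x) (f y) - d X x y) <= K)); trivial.
  - split.
    + tauto.
    + intros X hX. destruct (H X hX) as [Y [hYY [f hf]]]. now exists Y, f.
  - pose proof (Rle_abs K) as hK. pose proof (Rabs_pos K) as hK0. split.
    + exists (fun t => t + Rabs K). split; [|split].
      * intros t. lra.
      * intros s t. lra.
      * intros X Y f [_ [_ hf]] x y. specialize (hf x y).
        apply Rabs_le_bounds in hf. lra.
    + exists (fun t => Rmax 0 (t - Rabs K)). split; [|split; [|split]].
      * intros t _. apply Rmax_l.
      * intros s t _ hst. apply Rle_max_compat_l. lra.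
      * intros M. exists (M + Rabs K). intros t _ ht.
        pose proof (Rmax_r 0 (t - Rabs K)). lra.
      * intros X Y f [_ [_ hf]] x y. specialize (hf x y).
        apply Rabs_le_bounds in hf. apply Rmax_lub; [apply d_nonneg | lra].
Qed.

(** A space of diameter at most [K] is near isometric to a point, hence can be
    sent to any nonempty member of [YY]. If [YY] has no nonempty member, only
    uniformly bounded spaces remain. *)
Lemma near_isometric_in_class (K : R) (YY XX : metric_family) :
  C YY ->
  (forall X, XX X -> (forall x y : X, d X x y <= K) \/
     exists Y, YY Y /\ near_isometric K X Y) ->
  C XX.
Proof.
  intros hY H.
  destruct (classic (exists Y : Space, YY Y /\ exists y : Y, True))
    as [[Y0 [hY0 [y0 _]]] | hempty].
  - apply (near_isometric_in_class_strict K YY); trivial. intros X hX.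
    destruct (H X hX) as [hb | h]; [|exact h].
    exists Y0. split; trivial. exists (fun _ => y0). intros x y.
    rewrite d_refl, Rabs_minus_sym, Rminus_0_r.
    rewrite Rabs_right; [apply hb | apply Rle_ge, d_nonneg].
  - apply bounded_in_class. exists K. intros X hX x y.
    destruct (H X hX) as [hb | [Y [hYY [f _]]]]; [apply hb|].
    exfalso. apply hempty. exists Y. split; trivial. now exists (f x).
Qed.

Lemma subset_in_class (YY XX : metric_family) :
  C YY -> (forall X, XX X -> YY X) -> C XX.
Proof.
  intros hY H. apply (near_isometric_in_class 0 YY); trivial.
  intros X hX. right. exists X. split; [auto | apply near_isometric_refl].
Qed.

(** Map the members of [XX1] identically and those of [XX2] constantly to
    [XX1]. The inverse image of a bounded family consists of uniformly bounded
    spaces and of subspaces of members of [XX2], and such a family is near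
    isometric to [XX2]. *)
Lemma union_of_two_families_in_class (XX1 XX2 : metric_family) :
  C XX1 -> C XX2 -> C (fun X => XX1 X \/ XX2 X).
Proof.
  intros h1 h2.
  destruct (classic (exists Y : Space, XX1 Y /\ exists y : Y, True))
    as [[Y0 [hY0 [y0 _]]] | hempty].
  - pose (F := fun (X Y : Space) (f : X -> Y) => (XX1 X \/ XX2 X) /\ XX1 Y /\
      ((forall x y, d Y (f x) (f y) = d X x y) \/
       (XX2 X /\ forall x y, d Y (f x) (f y) = 0))).
    apply (hfib _ XX1 F); trivial.
    + split.
      * intros X Y f [hX [hY _]]. now split.
      * intros X [hX | hX].
        -- exists X, (fun x => x). split; [|split]; auto.
        -- exists Y0, (fun _ => y0). split; [|split]; auto.
           right. split; trivial. intros _ _. apply d_refl.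
    + exists (fun t => t). split; [|split].
      * now intros t.
      * now intros s t.
      * intros X Y f [_ [_ [hf | [_ hf]]]] x y; rewrite hf;
          [apply Rle_refl | apply d_nonneg].
    + intros ZZ _ [D hD]. apply (near_isometric_in_class (Rabs D) XX2); trivial.
      intros A [X [Y [f [S [[_ [_ hf]] [hZ ->]]]]]].
      destruct hf as [hf | [hX _]].
      * left. intros x y.
        apply Rle_trans with D; [|apply Rle_abs].
        destruct (subspace_point Y S (f (forget x))) as [p hp].
        { exact (forget_in X _ x). }
        destruct (subspace_point Y S (f (forget y))) as [q hq].
        { exact (forget_in X _ y). }
        change (d X (forget x) (forget y) <= D).
        rewrite <- hf, <- hp, <- hq. exact (hD _ hZ p q).
      * right. exists X. split; trivial. exists forget. intros x y.
        change (d X (forget x) (forget y))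
          with (d (subspace X (fun x => S (f x))) x y).
        rewrite Rminus_diag, Rabs_R0. apply Rabs_pos.
  - apply (near_isometric_in_class 0 XX2); trivial.
    intros X [hX | hX].
    + left. intros x. exfalso. apply hempty. exists X. split; trivial.
      now exists x.
    + right. exists X. split; [trivial | apply near_isometric_refl].
Qed.

Lemma finite_union_of_families_in_class (n : nat)
  (XXi : nat -> metric_family) :
  (forall i, (i < n)%nat -> C (XXi i)) ->
  C (fun X => exists i, (i < n)%nat /\ XXi i X).
Proof.
  induction n as [|n IH]; intros H.
  - apply bounded_in_class. exists 0. intros X [i [hi _]]. lia.
  - apply (subset_in_class
      (fun X => (exists i, (i < n)%nat /\ XXi i X) \/ XXi n X)).
    + apply union_of_two_families_in_class; [apply IH; auto | apply H; lia].
    + intros X [i [hi hX]].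
      destruct (Nat.eq_dec i n) as [-> | hne]; [now right | left].
      exists i. split; [lia | trivial].
Qed.

Lemma fibering_finite_amalgamation : finite_amalgamation_permanence C.
Proof.
  intros n XX XXi hXX H.
  apply (subset_in_class
    (fun X => exists i, (i < n)%nat /\ XXi (S i) X)).
  - apply finite_union_of_families_in_class with (XXi := fun i => XXi (S i)).
    intros i hi. apply H. lia.
  - intros X hX. apply hXX in hX. destruct hX as [[|i] [hi hX]]; [lia|].
    exists i. split; [lia | trivial].
Qed.

(** * Finite union permanence *)

(** Only a bound on the oscillation of [g] is retained of a bounded subset of
    the line. The relation [good] lets the fibres remember the data from which
    [g] was made. *)
Lemma lipschitz_fibering (XX : metric_family)
  (good : forall X : Space, (X -> R) -> Prop) :
  (forall X, XX X -> exists g, good X g) ->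
  (forall X g, good X g -> forall x y, g x <= g y + d X x y) ->
  (forall D, C (fun A => exists X g S, good X g /\ A = subspace X S /\
     forall x y, S x -> S y -> g x <= g y + D)) ->
  C XX.
Proof.
  intros hex hlip hC.
  apply (hfib XX (fun Y => Y = line)
           (fun X Y f => XX X /\ line_map good X Y f)).
  - split.
    + intros X Y f [hX hf]. split; trivial. now destruct hf.
    + intros X hX. destruct (hex X hX) as [g hg].
      exists line, (fun x => line_point (g x)). split; trivial.
      now constructor.
  - exists (fun t => t). split; [|split].
    + now intros t.
    + now intros s t.
    + intros X Y f [_ hf] x y. destruct hf as [X g hg]. rewrite line_dist.
      pose proof (hlip X g hg x y). pose proof (hlip X g hg y x).
      rewrite (d_sym X y x) in *. apply Rabs_le. unfold line_value; simpl. lra.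
  - apply hasdim, line_asdim.
  - intros ZZ _ [D hD]. apply (subset_in_class _ _ (hC D)).
    intros A [X [Y [f [S [[_ hf] [hZ ->]]]]]]. destruct hf as [X g hg].
    exists X, g, (fun x => S (line_point (g x))). split; [|split]; trivial.
    intros x y hx hy.
    destruct (subspace_point line S _ hx) as [p hp].
    destruct (subspace_point line S _ hy) as [q hq].
    pose proof (hD _ hZ p q) as h.
    change (d line (forget p) (forget q) <= D) in h.
    rewrite hp, hq, line_dist in h. apply Rabs_le_bounds in h.
    unfold line_value in h; simpl in h. lra.
Qed.

(** The distance to [S1] serves as the map to the line. A fibre that meets [S1]
    lies within [D + 1] of it; any other fibre lies in [S2]. *)
Lemma union_of_two_in_class (K : R) (XX1 XX2 XX : metric_family) :
  C XX1 -> C XX2 ->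
  (forall X, XX X -> exists S1 S2 : X -> Prop,
     (exists Y, XX1 Y /\ near_isometric K (subspace X S1) Y) /\
     (exists Y, XX2 Y /\ near_isometric K (subspace X S2) Y) /\
     forall x, S1 x \/ S2 x) ->
  C XX.
Proof.
  intros h1 h2 H.
  apply (lipschitz_fibering XX (fun X g => exists S1 S2 : X -> Prop,
     ((exists Y, XX1 Y /\ near_isometric K (subspace X S1) Y) /\
      (exists Y, XX2 Y /\ near_isometric K (subspace X S2) Y) /\
      forall x, S1 x \/ S2 x) /\ weighted_distance X (fun _ => S1) g)).
  - intros X hX. destruct (H X hX) as [S1 [S2 hS]].
    destruct (weighted_distance_exists X (fun _ => S1)) as [g hg].
    now exists g, S1, S2.
  - intros X g [S1 [S2 [_ hg]]]. apply hg.
  - intros D.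
    apply (near_isometric_in_class (Rmax (2 * (D + 1) + K) (0 + K))
      _ _ (union_of_two_families_in_class XX1 XX2 h1 h2)).
    intros A [X [g [S [[S1 [S2 [[[Y1 [hY1 n1]] [[Y2 [hY2 n2]] hcov]] hg]]]
                      [-> hS]]]]].
    right. destruct hg as [_ [hg0 hgW]].
    destruct (classic (exists b, S b /\ S1 b)) as [[b [hb hb1]] | hno].
    + exists Y1. split; [now left|].
      apply near_isometric_weaken with (2 * (D + 1) + K); [apply Rmax_l|].
      apply near_isometric_trans with (subspace X S1); trivial.
      apply near_isometric_to_subspace with forget; [reflexivity|].
      intros a. destruct (hgW (ex_intro _ 0%nat (ex_intro _ b hb1)) (forget a))
        as [n [y [hy hd]]].
      exists y. split; trivial.
      pose proof (hS (forget a) b (forget_in X S a) hb).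
      pose proof (hg0 0%nat b hb1). pose proof (pos_INR n). simpl in *. lra.
    + exists Y2. split; [now right|].
      apply near_isometric_weaken with (0 + K); [apply Rmax_r|].
      apply near_isometric_trans with (subspace X S2); trivial.
      apply isometric_to_subspace with forget; [reflexivity|].
      intros a. destruct (hcov (forget a)) as [h | h]; trivial.
      exfalso. apply hno. exists (forget a). split; [apply forget_in | trivial].
Qed.

(** Members of [XXi] are only reached up to near isometry. This absorbs
    neighbourhoods of subspaces, and it identifies a subspace of a subspace with
    a subspace in the induction. *)
Lemma finite_union_in_class (K : R) (n : nat) (XXi : nat -> metric_family)
  (XX : metric_family) :
  (forall i, (i < n)%nat -> C (XXi i)) ->
  (forall X, XX X -> exists S : nat -> X -> Prop,
     (forall i, (i < n)%nat ->
        exists Y, XXi i Y /\ near_isometric K (subspace X (S i)) Y) /\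
     (forall x, exists i, (i < n)%nat /\ S i x)) ->
  C XX.
Proof.
  revert XX. induction n as [|n IH]; intros XX hC H.
  - apply bounded_in_class. exists 0. intros X hX x.
    destruct (H X hX) as [S [_ hS]]. destruct (hS x) as [i [hi _]]. lia.
  - pose (XX1 := fun X : Space => exists S : nat -> X -> Prop,
      (forall i, (i < n)%nat ->
         exists Y, XXi i Y /\ near_isometric (0 + K) (subspace X (S i)) Y) /\
      (forall x, exists i, (i < n)%nat /\ S i x)).
    assert (h1 : C XX1).
    { apply IH.
      - intros i hi. apply hC. lia.
      - intros X [S [hS hcov]]. exists S. split; trivial.
        intros i hi. rewrite <- (Rplus_0_l K). now apply hS. }
    apply (union_of_two_in_class (Rmax 0 K) XX1 (XXi n)); auto.
    intros X hX. destruct (H X hX) as [S [hS hcov]].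
    exists (fun x => exists i, (i < n)%nat /\ S i x), (S n). split; [|split].
    + exists (subspace X (fun x => exists i, (i < n)%nat /\ S i x)).
      split; [|apply near_isometric_weaken with 0;
                [apply Rmax_l | apply near_isometric_refl]].
      exists (fun i x => S i (forget x)). split; [|intros x; apply (forget_in X _ x)].
      intros i hi. destruct (hS i ltac:(lia)) as [Y [hY hn]].
      exists Y. split; trivial.
      apply near_isometric_trans with (subspace X (S i)); trivial.
      apply isometric_to_subspace with (fun a => forget (forget a)).
      * reflexivity.
      * intros a. apply (forget_in _ _ a).
    + destruct (hS n ltac:(lia)) as [Y [hY hn]]. exists Y. split; trivial.
      now apply near_isometric_weaken with K; [apply Rmax_r|].
    + intros x. destruct (hcov x) as [i [hi hx]].
      destruct (Nat.eq_dec i n) as [-> | hne]; [now right | left].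
      exists i. split; [lia | trivial].
Qed.

Lemma fibering_finite_union : finite_union_permanence C.
Proof.
  intros n XXi XX hC H.
  apply (finite_union_in_class 0 n (fun i => XXi (S i))).
  - intros i hi. apply hC. lia.
  - intros X hX. destruct (H X hX) as [S [hS hcov]].
    exists (fun i => S (Datatypes.S i)). split.
    + intros i hi. exists (subspace X (S (Datatypes.S i))).
      split; [apply hS; lia | apply near_isometric_refl].
    + intros x. destruct (hcov x) as [[|i] [hi hx]]; [lia|].
      exists i. split; [lia | trivial].
Qed.

(** * Limit permanence *)

(** Pieces may be indexed differently in each space, and need only embed
    isometrically in members of [ZZ]; both freedoms are used for unions. *)
Lemma limit_in_class (XX : metric_family) :
  (forall r, 0 < r -> exists ZZ, C ZZ /\ forall X, XX X ->
     exists (J : Type) (U : J -> X -> Prop),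
       (forall x, exists j, U j x) /\ r_disjoint r X U /\
       forall j, exists Z, ZZ Z /\ near_isometric 0 (subspace X (U j)) Z) ->
  C XX.
Proof.
  intros H.
  apply (hfib XX (fun Y => exists X, XX X /\ Y = level_space X) (level_map XX)).
  - split.
    + intros _ _ _ [X hX]. split; trivial. now exists X.
    + intros X hX. exists (level_space X), (level_point X). now constructor.
  - exists (fun t => t + 1). split; [|split].
    + intros t. lra.
    + intros s t. lra.
    + intros _ _ _ [X hX] x y. rewrite level_dist. apply level_lipschitz.
  - apply hasdim, level_asdim.
  - intros ZZ _ [D hD]. destruct (nat_above D) as [n hn].
    destruct (H (INR n + 1)) as [WW [hW HW]].
    { pose proof (pos_INR n). lra. }
    apply (near_isometric_in_class 0 WW); trivial.
    intros A [X [Y [f [S [hf [hZ ->]]]]]]. destruct hf as [X hX].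
    (* [A] has level at most [n], so it cannot meet two pieces of a
       decomposition of disjointness [INR n + 1]. *)
    assert (hch : forall x y, S (level_point X x) -> S (level_point X y) ->
              chained X n x y).
    { intros x y hx hy.
      destruct (subspace_point _ S _ hx) as [p hp].
      destruct (subspace_point _ S _ hy) as [q hq].
      pose proof (hD _ hZ p q) as h.
      change (d (level_space X) (forget p) (forget q) <= D) in h.
      rewrite hp, hq, level_dist in h. simpl in h.
      apply level_le, INR_le. lra. }
    destruct (classic (exists b, S (level_point X b))) as [[b hb] | hempty].
    + right. destruct (HW X hX) as [J [U [hcov [hdis hU]]]].
      destruct (hcov b) as [j hj]. destruct (hU j) as [Z [hZ' hn']].
      exists Z. split; trivial. rewrite <- (Rplus_0_l 0).
      apply near_isometric_trans with (subspace X (U j)); trivial.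
      apply isometric_to_subspace with forget; [reflexivity|].
      intros a.
      apply (chained_same_piece X J U (INR n + 1) n b (forget a)); trivial.
      * lra.
      * apply hch; trivial. exact (forget_in X _ a).
    + left. intros a. exfalso. apply hempty. exists (forget a).
      exact (forget_in X _ a).
Qed.

Lemma fibering_limit : limit_permanence C.
Proof.
  intros I X H. apply limit_in_class. intros r hr.
  destruct (H r hr) as [J [U [hU hC]]].
  exists (fun A => exists i j, A = subspace (X i) (U i j)). split; trivial.
  intros A [i ->]. destruct (hU i) as [hcov hdis].
  exists J, (U i). split; [|split]; trivial.
  - intros x. now apply hcov.
  - intros j. exists (subspace (X i) (U i j)).
    split; [now exists i, j | apply near_isometric_refl].
Qed.

(** * Union permanence *)

(** One separating subspace [V n] is kept for each integral scale; the extra 1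
    makes the scale positive when [n] is 0. *)
Definition exhausted_union (WW : metric_family) (YY : nat -> metric_family)
  (X : Space) (J : Type) (U : J -> X -> Prop) (V : nat -> X -> Prop) : Prop :=
  (forall x, exists j, U j x) /\
  (forall j, WW (subspace X (U j))) /\
  (forall n, YY n (subspace X (V n))) /\
  (forall n, r_disjoint (INR n + 1) X (fun j x => U j x /\ ~ V n x)).

(** Fibering over the weighted distance to the [V n] leaves families of
    subspaces on which that function oscillates by at most [D]; Limit Permanence
    handles these. At scale [r <= INR m], a subspace that meets [V m] is kept
    whole, being a finite union of pieces close to [V 0], ..., [V N]; a subspace
    that misses [V m] is cut along the [U j]. *)
Lemma exhausted_union_in_class (XX WW : metric_family)
  (YY : nat -> metric_family) :
  C WW -> (forall n, C (YY n)) ->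
  (forall X, XX X -> exists J U V, exhausted_union WW YY X J U V) ->
  C XX.
Proof.
  intros hW hY H.
  apply (lipschitz_fibering XX (fun X g => exists J U V,
           exhausted_union WW YY X J U V /\ weighted_distance X V g)).
  - intros X hX. destruct (H X hX) as [J [U [V hU]]].
    destruct (weighted_distance_exists X V) as [g hg]. now exists g, J, U, V.
  - intros X g [J [U [V [_ hg]]]]. apply hg.
  - intros D. apply limit_in_class. intros r _.
    destruct (nat_above r) as [m hm].
    (* The weighted distance is at most [INR m + D] on a subspace that meets
       [V m]; being an infimum attained up to 1, it is there realised by some
       [V n] with both [n] and the distance at most [N]. *)
    destruct (nat_above (INR m + D + 1)) as [N hN].
    pose (ZZ := fun A : Space => exists S : nat -> A -> Prop,
      (forall i, (i < Datatypes.S N)%nat -> exists Y, YY i Y /\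
         near_isometric (2 * INR N) (subspace A (S i)) Y) /\
      (forall x, exists i, (i < Datatypes.S N)%nat /\ S i x)).
    exists (fun A => WW A \/ ZZ A). split.
    + apply union_of_two_families_in_class; trivial.
      apply (finite_union_in_class (2 * INR N) (Datatypes.S N) YY); auto.
    + intros A [X [g [S [[J [U [V [[hcov [hU [hV hdis]]] hg]]]] [-> hS]]]]].
      destruct hg as [_ [hgV hgW]].
      destruct (classic (exists b, S b /\ V m b)) as [[b [hb hbm]] | hno].
      * exists unit, (fun _ _ => True). split; [|split].
        -- intros _. now exists tt.
        -- intros [] []. now intros [].
        -- intros _. exists (subspace X S).
           split; [|apply isometric_near_isometric with forget; reflexivity].
           right.
           exists (fun i a => exists y, V i y /\ d X (forget a) y <= INR N).
           split.
           ++ intros i _. exists (subspace X (V i)). split; trivial.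
              apply near_isometric_to_subspace with (fun a => forget (forget a)).
              ** reflexivity.
              ** intros a. exact (forget_in _ _ a).
           ++ intros a.
              destruct (hgW (ex_intro _ m (ex_intro _ b hbm)) (forget a))
                as [i [y [hy hd]]].
              pose proof (hS (forget a) b (forget_in X S a) hb).
              pose proof (hgV m b hbm). pose proof (d_nonneg X (forget a) y).
              pose proof (pos_INR i).
              exists i. split; [|exists y; split; [trivial | lra]].
              apply Nat.lt_succ_r, INR_le. lra.
      * exists J, (fun j a => U j (forget a)). split; [|split].
        -- intros a. apply hcov.
        -- intros j k hjk a b ha hb.
           assert (hout : forall c : subspace X S, ~ V m (forget c)).
           { intros c hc. apply hno. exists (forget c).
             split; [apply forget_in | trivial]. }
           apply Rle_lt_trans with (INR m + 1); [lra|].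
           apply (hdis m j k hjk (forget a) (forget b)); split; auto.
        -- intros j. exists (subspace X (U j)). split; [now left|].
           apply isometric_to_subspace with (fun a => forget (forget a)).
           ++ reflexivity.
           ++ intros a. exact (forget_in _ _ a).
Qed.

Lemma fibering_union : union_permanence C.
Proof.
  intros I X J U hcov hU H.
  assert (HV : forall n : nat, exists V : forall i, X i -> Prop,
    C (indexed_family (fun i => subspace (X i) (V i))) /\
    forall i, r_disjoint (INR n + 1) (X i) (fun j x => U i j x /\ ~ V i x)).
  { intros n. apply H. pose proof (pos_INR n). lra. }
  destruct (functional_choice _ HV) as [V hV].
  apply (exhausted_union_in_class (indexed_family X)
    (fun A => exists i j, A = subspace (X i) (U i j))
    (fun n => indexed_family (fun i => subspace (X i) (V n i)))); trivial.
  - intros n. apply hV.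
  - intros A [i ->]. exists (J i), (U i), (fun n => V n i).
    split; [|split; [|split]].
    + apply hcov.
    + intros j. now exists i, j.
    + intros n. now exists i.
    + intros n. apply hV.
Qed.

End Fibering.

Theorem theorem1p1 (C : metric_family -> Prop)
  (hfib : fibering_permanence C)
  (hasdim : forall XX : metric_family, finite_asdim XX -> C XX) :
  coarse_permanence C /\
  finite_amalgamation_permanence C /\
  finite_union_permanence C /\
  union_permanence C /\
  limit_permanence C.
Proof.
  repeat split.
  - now apply fibering_coarse.
  - now apply fibering_finite_amalgamation.
  - now apply fibering_finite_union.
  - now apply fibering_union.
  - now apply fibering_limit.
Qed.
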